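(* No infinite successor cardinal is paracompact. In fact, there is no infinite cardinal $\kappa$ such that the space ${}^{<\kappa^+}\square\,2^{\kappa^{++}}$ is normal.
   Context: $2=\{0,1\}$ is discrete. For cardinals $\mu\le\lambda$, ${}^{<\mu}\square\,2^\lambda$ is the set of functions $\lambda\to2$ with basic open sets $[s]=\{f:s\subseteq f\}$ for partial functions $s:\lambda\to2$ with $|\mathrm{dom}(s)|<\mu$. A cardinal $\mu$ is $\lambda$-paracompact (for $\lambda\ge\mu$) if ${}^{<\mu}\square\,2^\lambda$ is paracompact, and $\mu$ is paracompact if it is $\lambda$-paracompact for every $\lambda\ge\mu$. *)

(* Defs.v *)
From HB Require Import structures.
From mathcomp Require Import all_boot.
From mathcomp Require Import all_classical.
From mathcomp Require Import topology.

Set Implicit Arguments.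
Unset Strict Implicit.
Unset Printing Implicit Defensive.

Local Open Scope classical_set_scope.
Local Open Scope card_scope.

(* A cardinal is represented by a type having that cardinality, so equality of
   cardinals is [#=] and their order is [#<=]. Going through this constant
   keeps all cardinals in one universe. *)
Definition cardinal := Type.

Definition card_lt T U (A : set T) (B : set U) : Prop :=
  (A #<= B) /\ ~ (B #<= A).

(* [mu] represents the least cardinal above that of [kappa]. *)
Definition is_succ_card (kappa mu : cardinal) : Prop :=
  card_lt [set: kappa] [set: mu] /\
  forall nu : cardinal,
    card_lt [set: kappa] [set: nu] -> [set: mu] #<= [set: nu].

Lemma inj_fun_card_le (T U : Type) (f : T -> U) :
  injective f -> [set: T] #<= [set: U].
Proof.
move=> injf; have [g] : $|{injfun [set: T] >-> [set: U]}|.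
  by apply/injfunPex; exists f => // x y _ _; exact: injf.
exact: inj_card_le g.
Qed.

(* Every nonempty family of cardinals has a least member. *)
Lemma minimal_card (I : Type) (A : I -> Type) : inhabited I ->
  exists i, forall j, [set: A i] #<= [set: A j].
Proof.
case=> i0.
pose P : set (set (forall i, A i)) := [set S | forall f g i,
  S f -> S g -> f i = g i -> f = g].
have [|S [PS maxS]] := @Zorn_bigcup _ P.
  move=> F FP Ftot f g i [X FX Xf] [Y FY Yg] fg.
  have [XY|YX] := Ftot _ _ FX FY.
    by apply: (FP _ FY _ _ i) => //; exact: XY.
  by apply: (FP _ FX _ _ i) => //; exact: YX.
have [i Si] : exists i, forall a : A i, exists f, S f /\ f i = a.
  apply: contrapT => nS.
  have H : forall i, exists a : A i, forall f, S f -> f i <> a.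
    move=> i; apply: contrapT => nex; apply: nS; exists i => a.
    apply: contrapT => na; apply: nex; exists a => f Sf fa.
    by apply: na; exists f.
  pose h i := sval (cid (H i)).
  have hS i f : S f -> f i <> h i by exact: (svalP (cid (H i))).
  apply: (maxS (S `|` [set h])).
    split=> [f|sub]; first by left.
    by apply: (hS i0 h) => //; apply: sub; right.
  move=> f g i [Sf|->] [Sg|->] //; first exact: PS.
  - by move=> /(hS _ _ Sf).
  - by move=> /esym /(hS _ _ Sg).
exists i => j.
pose e a := sval (cid (Si a)).
have eP a : S (e a) /\ e a i = a by exact: (svalP (cid (Si a))).
apply: (@inj_fun_card_le _ _ (fun a => e a j)) => a b eab.
have [Sa <-] := eP a; have [Sb <-] := eP b.
by rewrite (PS _ _ _ Sa Sb eab).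
Qed.

Lemma card_lt_powerset (T : Type) : card_lt [set: T] [set: set T].
Proof.
split.
  apply: (@inj_fun_card_le _ _ set1) => x y xy.
  by have : [set y] x by rewrite -xy.
move=> /card_leP [f].
pose g (A : set T) : T := val (f (SigSub (mem_set (I : [set: set T] A)))).
have injg : injective g.
  move=> A B /val_inj /(inj (mem_set I) (mem_set I)) /(congr1 val).
  by [].
pose D := [set x | exists A, g A = x /\ ~ A x].
have nD : ~ D (g D) by move=> [A [/injg ->]] nD; apply: (nD); exists D.
by apply: (nD); exists D.
Qed.

Lemma exists_succ_card (kappa : cardinal) :
  exists mu : cardinal, is_succ_card kappa mu.
Proof.
pose J := {B : set (set kappa) | card_lt [set: kappa] B}.
have [[B0 B0P] B0min] := @minimal_card J (fun i => set_type (sval i))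
  (inhabits (exist _ setT (card_lt_powerset kappa))).
have setTE T (B : set T) : [set: set_type B] #= B by exact: card_setT.
exists (set_type B0); split=> [|nu [le_nu nle_nu]].
  by rewrite /card_lt (card_le_eqr (setTE _ _)) (card_le_eql (setTE _ _)).
have lt_image (f : nu -> set kappa) : injective f ->
    card_lt [set: kappa] (range f).
  move=> injf; rewrite /card_lt.
  have E : range f #= [set: nu] by apply: inj_card_eq => x y _ _; exact: injf.
  by rewrite (card_le_eqr E) (card_le_eql E).
have [|] := @minimal_card bool (fun b => if b then nu else set kappa).
  exact: (inhabits true).
case=> [/(_ false)|/(_ true)] cmp.
  have [f injf] : exists f : nu -> set kappa, injective f.
    move: cmp => /pcard_injP[f injf]; exists f => x y.
    by apply: injf; exact/mem_set.
  have E : range f #= [set: nu] by apply: inj_card_eq => x y _ _; exact: injf.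
  have := B0min (exist _ _ (lt_image _ injf)).
  by rewrite /= (card_le_eqr (setTE _ _)) (card_le_eqr E).
apply: card_le_trans cmp.
have := B0min (exist _ _ (card_lt_powerset kappa)).
by rewrite /= (card_le_eqr (setTE _ _)).
Qed.

Definition locally_finite (T : topologicalType) (V : set (set T)) : Prop :=
  forall x : T, exists2 N, nbhs x N &
    finite_set [set W | V W /\ N `&` W !=set0].

(* The Hausdorff axiom, which some authors include in paracompactness, is not
   part of this definition. *)
Definition paracompact_space (T : topologicalType) : Prop :=
  forall U : set (set T),
    (forall A, U A -> open A) -> \bigcup_(A in U) A = setT ->
  exists V : set (set T),
    [/\ forall B, V B -> open B,
        \bigcup_(B in V) B = setT,
        forall B, V B -> exists2 A, U A & B `<=` A &
        locally_finite V].

(* The functions from [lambda] to 2, with the topology attached below; the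
   parameter [mu] only serves to select that topology. *)
Definition box_space (mu lambda : cardinal) : Type := lambda -> bool.

Section BoxSpace.
Variables mu lambda : cardinal.

(* A partial function from [lambda] to 2; [None] means "undefined". *)
Definition partial_fun := lambda -> option bool.

Definition dom (s : partial_fun) : set lambda := [set a | s a <> None].

(* The set [s] of total functions extending the partial function s. *)
Definition extensions (s : partial_fun) : set (box_space mu lambda) :=
  [set f | forall a b, s a = Some b -> f a = b].

HB.instance Definition _ := Choice.on (box_space mu lambda).
HB.instance Definition _ := isPointed.Build partial_fun (fun=> None).

(* The topology generated by the sets [s] with |dom s| < mu. When mu is
   infinite, a union of two sets of cardinality < mu again has cardinality
   < mu, so these sets are then a base and not merely a subbase. *)
HB.instance Definition _ := @isSubBaseTopological.Build
  (box_space mu lambda) partial_fun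
  [set s | card_lt (dom s) [set: mu]] extensions.

End BoxSpace.

Definition paracompact_at (lambda mu : cardinal) : Prop :=
  paracompact_space (box_space mu lambda).

Definition paracompact_card (mu : cardinal) : Prop :=
  forall lambda : cardinal,
    [set: mu] #<= [set: lambda] -> paracompact_at lambda mu.

(* Main.v *)
Require Import Defs.
From mathcomp Require Import all_boot finmap all_classical topology.

(* Fix an injection of kappa^+ into 2^kappa and one of kappa^++ * kappa into
   kappa^++, and cut a point of 2^(kappa^++) into kappa^++ rows in 2^kappa. As
   in A. H. Stone's proof that N^(omega_1) is not normal, let Q_c be the closed
   set of points whose rows all come from kappa^+ and which repeat no row other
   than c. For c0 <> c1 the sets Q_c0 and Q_c1 are disjoint, because there is no
   injection of kappa^++ into kappa^+. Suppose an open U contains Q_c0. Every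
   injective partial assignment p of rows other than c0 and c1, filled up with
   c0, lies in Q_c0, so some set S p of at most kappa rows decides membership in
   U. Take a maximal chain of assignments p of size at most kappa in which a
   smaller p always has S p inside the domain of a larger one, and let e be its
   union. Filling e up with c1 gives a point of Q_c1 every neighbourhood of
   which meets U: the part of dom e seen by the neighbourhood lies in dom p for
   a single p such that S p is inside dom e. *)

Local Open Scope classical_set_scope.
Local Open Scope card_scope.

Set Implicit Arguments.
Unset Strict Implicit.
Unset Printing Implicit Defensive.

(** * Comparison of cardinalities by injections *)

Definition inj_on T U (A : set T) (f : T -> U) :=
  forall x y, A x -> A y -> f x = f y -> x = y.

Lemma card_le_injP T U (A : set T) (B : set U) (u0 : U) :
  A #<= B <-> exists f : T -> U, (forall x, A x -> B (f x)) /\ inj_on A f.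
Proof.
elim/Ppointed: U => U in B u0 *; first by case: (no u0).
split=> [/pcard_leP /injfunPex[f fAB injf]|[f [fAB injf]]].
  by exists f; split=> // x y Ax Ay; apply: injf; apply/mem_set.
apply/pcard_leP/injfunPex; exists f => // x y /set_mem Ax /set_mem Ay.
exact: injf.
Qed.

Lemma inj_on_inv T U (A : set T) (f : T -> U) (t0 : T) :
  inj_on A f -> exists g, forall x, A x -> g (f x) = x.
Proof.
move=> injf.
have H u : exists x, forall y, A y -> f y = u -> y = x.
  have [[x Ax <-]|nu] := pselect ((f @` A) u).
    by exists x => y Ay /injf; exact.
  by exists t0 => y Ay yu; case: nu; exists y.
exists (fun u => sval (cid (H u))) => x Ax.
by rewrite -(svalP (cid (H (f x))) x).
Qed.

(** The two sets form a family of cardinals, and its least member lies below the other one. *)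
Lemma card_le_total T U (A : set T) (B : set U) : A #<= B \/ B #<= A.
Proof.
have E V (C : set V) : [set: set_type C] #= C by exact: card_setT.
have [[] cmp] := @minimal_card bool
  (fun b => if b then set_type A else set_type B) (inhabits true).
- by left; have := cmp false;
    rewrite (card_le_eql (E _ _)) (card_le_eqr (E _ _)).
- by right; have := cmp true;
    rewrite (card_le_eql (E _ _)) (card_le_eqr (E _ _)).
Qed.

(** * The square of an infinite set *)

Section Square.
Variable T : Type.
Implicit Types (A : set T) (f : T -> T -> T) (G : set (T * T * T)).

(** Zorn's lemma is applied to graphs ordered by inclusion; the diagonal of a graph recovers the set
    on which the pairing lives. *)
Let field G := [set x | exists z, G (x, x, z)].

Let pairing A f := (forall x y, A x -> A y -> A (f x y)) /\
  forall x y x' y', A x -> A y -> A x' -> A y' ->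
    f x y = f x' y' -> x = x' /\ y = y'.

Let graph A f : set (T * T * T) :=
  [set t | [/\ A t.1.1, A t.1.2 & t.2 = f t.1.1 t.1.2]].

Let field_graph A f : field (graph A f) = A.
Proof. by apply/seteqP; split=> [x [z []]|x Ax]//; exists (f x x). Qed.

(** Take a maximal injection [f] of the square of a set [A] into [A]. Either the complement of [A]
    injects into [A], and then so does [T], or [A] injects into its complement, and [f] extends to a
    larger set, against maximality. *)
Lemma card_le_square : infinite_set [set: T] -> [set: T * T] #<= [set: T].
Proof.
move=> infT; have [t0 _] := infinite_setN0 infT.
have [i [_ inji]] : exists i : nat -> T, (forall n, setT n -> setT (i n)) /\
    inj_on setT i by apply/(card_le_injP _ _ t0)/infiniteP.
(* The case [A = set0] admits the union of the empty chain; a nonempty [A] must contain the copy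
   [range i] of the naturals. *)
pose P G := exists A f, [/\ G = graph A f, pairing A f &
  A = set0 \/ forall n, A (i n)].
have [F FP Ftot|] := @Zorn_bigcup _ P.
  have FE G : F G -> exists f,
      [/\ G = graph (field G) f, pairing (field G) f &
        field G = set0 \/ forall n, field G (i n)].
    by move=> /FP[A [f [-> pf Ai]]]; exists f; rewrite field_graph.
  pose A := [set x | exists2 G, F G & field G x].
  have two x y : A x -> A y -> exists G, [/\ F G, field G x & field G y].
    move=> [G FG Gx] [H FH Hy]; have [GH|HG] := Ftot _ _ FG FH.
      by exists H; split=> //; case: Gx => z /GH ?; exists z.
    by exists G; split=> //; case: Hy => z /HG ?; exists z.
  have up G H x : G `<=` H -> field G x -> field H x.
    by move=> GH [z /GH ?]; exists z.
  have ex x y : A x -> A y -> exists z, exists2 G, F G & G (x, y, z).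
    move=> Ax Ay; have [G [FG Gx Gy]] := two _ _ Ax Ay.
    have [f [GE pf _]] := FE _ FG.
    by exists (f x y), G => //; rewrite GE; split.
  have [f0 f0P] : exists f, forall x y, A x -> A y ->
      exists2 G, F G & G (x, y, f x y).
    have H x y : exists z, A x -> A y -> exists2 G, F G & G (x, y, z).
      have [Ax|nAx] := pselect (A x); last by exists t0.
      have [Ay|nAy] := pselect (A y); last by exists t0.
      by have [z zP] := ex _ _ Ax Ay; exists z.
    exists (fun x y => sval (cid (H x y))) => x y.
    exact: (svalP (cid (H x y))).
  (* Two triples of the union lie in one graph of the chain, so single-valuedness and injectivity
     pass to the union. *)
  have two3 t t' : (\bigcup_(X in F) X) t -> (\bigcup_(X in F) X) t' ->
      exists G f, [/\ F G, graph (field G) f t, graph (field G) f t' &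
         pairing (field G) f].
    move=> [G FG Gt] [H FH Ht].
    have [f [GE pf _]] := FE _ FG; have [g [HE pg _]] := FE _ FH.
    have [GH|HG] := Ftot _ _ FG FH.
      by exists H, g; split=> //; rewrite -HE//; exact: GH.
    by exists G, f; split=> //; rewrite -GE//; exact: HG.
  exists A, f0; split.
  - apply/seteqP; split=> [[[x y] z] [G FG Gxyz]|[[x y] z] [/= Ax Ay ->]].
      have [f [GE pf _]] := FE _ FG.
      have := Gxyz; rewrite {1}GE => -[/= Gx Gy zE].
      have Ax : A x by exists G.
      have Ay : A y by exists G.
      split=> //=.
      have [||G' [f' [FG' [_ _ /= ->] [_ _ /= ->]]]//] :=
        two3 (x, y, z) (x, y, f0 x y); first by exists G.
      by have [G' ? ?] := f0P _ _ Ax Ay; exists G'.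
    by have [G' ? ?] := f0P _ _ Ax Ay; exists G'.
  - split=> [x y Ax Ay|x y x' y' Ax Ay Ax' Ay' eqf].
      have [G FG Gxy] := f0P _ _ Ax Ay.
      have [f [GE pf _]] := FE _ FG.
      by move: Gxy; rewrite GE => -[/= Gx Gy ->]; exists G => //; exact: pf.1.
    have [G FG Gxy] := f0P _ _ Ax Ay; have [H FH Hxy] := f0P _ _ Ax' Ay'.
    have [||K [k [FK [/= Kx Ky e1] [/= Kx' Ky' e2] pk]]] :=
      two3 (x, y, f0 x y) (x', y', f0 x' y'); [by exists G|by exists H|].
    by apply: pk.2 => //; rewrite -e1 -e2.
  - have [Ai|nA] := pselect (forall n, A (i n)); first by right.
    left; apply/seteqP; split=> // x [G FG Gx]; apply: nA => n.
    have [f [_ _ [G0|Gi]]] := FE _ FG; first by rewrite G0 in Gx.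
    by exists G.
move=> _ [[A [f [-> [fA injf] Ai]]] maxA].
have {}maxA A' f' : A `<=` A' -> pairing A' f' -> (forall n, A' (i n)) ->
    (forall x y, A x -> A y -> f' x y = f x y) -> A' `<=` A.
  move=> AA' pf' Ai' ff' x A'x; apply: contrapT => nAx.
  apply: (maxA (graph A' f')); last by exists A', f'; split=> //; right.
  split=> [[[x1 x2] x3] [/= Ax1 Ax2 ->]|sub].
    by split=> /=; [exact: AA'|exact: AA'|rewrite ff'].
  by have [/nAx] : graph A f (x, x, f' x x) by apply: sub; split.
have {}Ai n : A (i n).
  have [A0|//] := Ai.
  (* Were [A] empty, a pairing of the naturals carried over to [range i] would extend it
     properly. *)
  have [pair injp] : exists p : nat * nat -> nat, injective p.
    by exists choice.pickle; exact: (pcan_inj choice.pickleK).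
  pose i' x := get [set n | i n = x].
  apply: (maxA (range i) (fun x y => i (pair (i' x, i' y)))); last by exists n.
  - by rewrite A0.
  - have iK m : i' (i m) = m.
      by apply: inji => //; apply: (@getPex _ [set n | i n = i m]); exists m.
    split=> [_ _ [a _ <-] [b _ <-]|_ _ _ _ [a _ <-] [b _ <-] [c _ <-] [d _ <-]].
      by eexists.
    by move=> /(inji _ _ I I)/injp; rewrite !iK => -[-> ->].
  - by move=> m; exists m.
  - by rewrite A0.
have i01 : i 0%N <> i 1%N by move=> /(inji _ _ I I).
suff [h [hA injh]] : exists h : T -> T,
    (forall x, setT x -> A (h x)) /\ inj_on setT h.
  apply/(card_le_injP _ _ t0); exists (fun p => f (h p.1) (h p.2)); split=> //.
  move=> [a b] [c d] _ _ /= /injf[]; try exact: hA.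
  by move=> /(injh _ _ I I) -> /(injh _ _ I I) ->.
have [|] := card_le_total (~` A) A => /(card_le_injP _ _ t0)[g [gA injg]].
  (* The tags [i 0] and [i 1] keep the images of [A] and of its complement apart. *)
  exists (fun x => if pselect (A x) then f x (i 0%N) else f (g x) (i 1%N)).
  split.
    by move=> x _; case: pselect => Ax; apply: fA => //; exact: gA.
  move=> x y _ _; case: pselect => Ax; case: pselect => Ay /injf[]//;
    try exact: gA.
    by move=> _ e; case: i01.
  by move=> + _; exact: injg.
(* [A'] is [A] with a disjoint copy of itself; [r] will give the original in [A] of a point, and [j]
   will tell the two halves apart. *)
pose A' := A `|` g @` A.
have Ag x : A x -> ~ A (g x) by exact: gA.
have [g' g'K] := inj_on_inv t0 injg.
pose r x := if pselect (A x) then x else g' x.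
have rA x : A x -> r x = x by rewrite /r; case: pselect.
have rg x : A x -> r (g x) = x.
  by move=> Ax; rewrite /r; case: pselect => [/(Ag _ Ax)//|?]; exact: g'K.
have Ar x : A' x -> A (r x) by move=> [Ax|[a Aa <-]]; [rewrite rA|rewrite rg].
pose j x := if pselect (A x) then i 0%N else i 1%N.
have Aj x : A (j x) by rewrite /j; case: pselect => ?; exact: Ai.
have rj x y : A' x -> A' y -> r x = r y -> j x = j y -> x = y.
  rewrite /j; move=> [Ax|[a Aa <-]] [Ay|[b Ab <-]].
  - by rewrite !rA.
  - by case: pselect => // ?; case: pselect => [/(Ag _ Ab)//|? _ /i01].
  - by case: pselect => [/(Ag _ Aa)//|?]; case: pselect => // ? _ /esym/i01.
  - by rewrite !rg// => ->.
(* New pairs are coded inside [A] by [f] and then moved out of [A] by [g], so they cannot collide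
   with old values of [f]. *)
pose f' x y := if pselect (A x /\ A y) then f x y else
  g (f (f (r x) (r y)) (f (j x) (j y))).
have Af' x y : A' x -> A' y -> A (f (f (r x) (r y)) (f (j x) (j y))).
  by move=> Ax Ay; apply: (fA); apply: fA => //; exact: Ar.
have sub : A' `<=` A.
  apply: (maxA A' f') => [x|||x y Ax Ay]; [by left| |by left|]; last first.
    by rewrite /f'; case: pselect => // -[].
  split=> [x y A'x A'y|x y z t A'x A'y A'z A't]; rewrite /f'.
    case: pselect => [[Ax Ay]|?]; [by left; exact: fA|right].
    by apply: imageP; exact: Af'.
  have fAr a b : A' a -> A' b -> A (f (r a) (r b))
    by move=> ? ?; apply: fA; exact: Ar.
  case: pselect => [[Ax Ay]|nxy]; case: pselect => [[Az At]|nzt] /=.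
  - exact: injf.
  - by move=> e; case: (Ag _ (Af' z t A'z A't)); rewrite -e; exact: fA.
  - by move=> e; case: (Ag _ (Af' x y A'x A'y)); rewrite e; exact: fA.
  - move=> /(injg _ _ (Af' _ _ A'x A'y) (Af' _ _ A'z A't)).
    move=> /injf[]; [exact: fAr|exact: fA|exact: fAr|exact: fA|].
    move=> /injf[]; [exact: Ar..|] => rxz ryt /injf[]// jxz jyt.
    by split; apply: rj.
by case: (Ag _ (Ai 0%N)); apply: sub; right; exists (i 0%N).
Qed.
End Square.

(** * Sets of size at most an infinite cardinal *)

Section InfiniteBound.
Variable K : Type.
Hypothesis infK : infinite_set [set: K].

(** A point goes to a chosen index whose member contains it, paired with its code in that member;
    this injects the union into [K * K]. *)
Lemma card_le_bigcup I T (J : set I) (F : I -> set T) :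
  J #<= [set: K] -> (forall i, J i -> F i #<= [set: K]) ->
  \bigcup_(i in J) F i #<= [set: K].
Proof.
have [k0 _] := infinite_setN0 infK.
move=> /(card_le_injP _ _ k0)[u [_ inju]] Fle.
apply: card_le_trans (card_le_square infK).
have H i : exists f : T -> K, J i -> inj_on (F i) f.
  have [Ji|nJi] := pselect (J i); last by exists (fun=> k0).
  by have /(card_le_injP _ _ k0)[f [_ injf]] := Fle _ Ji; exists f.
pose f i := sval (cid (H i)).
have fP i : J i -> inj_on (F i) (f i) := svalP (cid (H i)).
have [[i0]|nI] := pselect (inhabited I); last first.
  rewrite (_ : \bigcup_(i in J) F i = set0) ?card_ge0//.
  by apply/seteqP; split=> // x [i]; case: nI.
have Hi x : exists i, (\bigcup_(i in J) F i) x -> J i /\ F i x.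
  have [[i Ji Fi]|n] := pselect ((\bigcup_(i in J) F i) x); last by exists i0.
  by exists i.
pose c x := sval (cid (Hi x)); have cP x := svalP (cid (Hi x)).
apply/(card_le_injP _ _ (k0, k0)).
exists (fun x => (u (c x), f (c x) x)); split=> // x y /cP[Jx Fx] /cP[Jy Fy].
move=> [/(inju _ _ Jx Jy) cxy]; rewrite /c in cxy *.
by rewrite cxy in Jx Fx *; exact: fP.
Qed.

Lemma card_le_setU T (A B : set T) :
  A #<= [set: K] -> B #<= [set: K] -> A `|` B #<= [set: K].
Proof.
move=> Ale Ble.
have -> : A `|` B = \bigcup_(b in [set: bool]) (if b then A else B).
  apply/seteqP; split=> [x [Ax|Bx]|x [[] _ ?]].
  - by exists true.
  - by exists false.
  - by left.
  - by right.
apply: card_le_bigcup => [|[]//].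
by apply: (card_le_trans _ ((infiniteP _).1 infK)); exact: finite_set_countable.
Qed.

Lemma finite_card_le T (A : set T) : finite_set A -> A #<= [set: K].
Proof.
move=> /finite_set_countable/card_le_trans; apply; exact/infiniteP.
Qed.

(** The complement of [A] cannot be of size at most [K], or [D] would be; by comparability [K]
    injects into it. *)
Lemma card_gt_avoid D : ~ ([set: D] #<= [set: K]) ->
  forall A : set D, A #<= [set: K] ->
  exists u : K -> D, (forall k, ~ A (u k)) /\ injective u.
Proof.
move=> Dgt A Ale.
have nAc : ~ (~` A #<= [set: K]).
  by move=> /(card_le_setU Ale); rewrite setUCr.
have [d0 _] : (~` A) !=set0.
  apply/set0P/eqP => A0; apply: nAc; rewrite A0; exact: card_ge0.
have [//|/(card_le_injP _ _ d0)[u [uA inju]]] := card_le_total (~` A) [set: K].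
by exists u; split=> [k|x y]; [exact: uA|exact: inju].
Qed.

(** * Stone's argument for functions into a large discrete set *)

Section Stone.
Variables (I D : Type) (c0 c1 : D).
Hypothesis Dgt : ~ ([set: D] #<= [set: K]).

(** This is Q_c, each row being replaced by its name in [D]. *)
Definition injective_off (c : D) : set (I -> D) :=
  [set f | forall i j, f i = f j -> i = j \/ f i = c].

(** Neighbourhoods in a product of discrete copies of [D] whose basic open sets fix at most [K]
    coordinates. *)
Definition box_nbhs (f : I -> D) (U : set (I -> D)) :=
  exists2 S : set I, S #<= [set: K] &
    forall g, (forall i, S i -> g i = f i) -> U g.

Let dom (p : I -> option D) : set I := [set i | p i <> None].

Let fill (p : I -> option D) c i := odflt c (p i).

(** Both [c0] and [c1] are avoided, so that filling up with either one repeats only that value. *)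
Let pinj (p : I -> option D) :=
  (forall i j d, p i = Some d -> p j = Some d -> i = j) /\
  (forall i d, p i = Some d -> d <> c0 /\ d <> c1).

Let extends (p q : I -> option D) := forall i d, p i = Some d -> q i = Some d.

Let extends_dom p q : extends p q -> dom p `<=` dom q.
Proof.
by move=> pq i; rewrite /dom /=; case: (p i) (pq i) => // d /(_ _ erefl) ->.
Qed.

Let fill_off p c : pinj p -> c = c0 \/ c = c1 -> injective_off c (fill p c).
Proof.
move=> [injp pc] cE i j; rewrite /fill.
case pi: (p i) => [d|]; case pj: (p j) => [d'|] //=.
- by move=> dd'; left; apply: injp pj; rewrite -dd'.
- by move=> ->; right.
- by move=> _; right.
- by move=> _; right.
Qed.

(** The new coordinates receive distinct values outside the small set formed by the values of [p],
    [c0] and [c1]. *)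
Let extend_dom p (S : set I) : pinj p -> dom p #<= [set: K] -> S #<= [set: K] ->
  exists q, [/\ pinj q, dom q #<= [set: K], extends p q & S `<=` dom q].
Proof.
move=> [injp pc] ple Sle; have [k0 _] := infinite_setN0 infK.
pose X := [set d | exists i, p i = Some d].
have Xle : X #<= [set: K].
  apply: card_le_trans ple.
  have -> : X = (fun i => odflt c0 (p i)) @` dom p.
    apply/seteqP; split=> [d [i pid]|_ [i + <-]]; rewrite /dom /=.
      by exists i; rewrite /= pid.
    by case pi: (p i) => [d|]//= _; exists i.
  exact: card_image_le.
have [|u [uX inju]] := card_gt_avoid Dgt (A := X `|` [set c0; c1]).
  by apply: card_le_setU => //; apply: finite_card_le; exact: finite_set2.
have /(card_le_injP _ _ k0)[v [_ injv]] := Sle.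
pose q i := if p i is Some d then Some d else
  if pselect (S i) then Some (u (v i)) else None.
exists q; split.
- split=> [i j d|i d]; rewrite /q.
    case pi: (p i) => [e|]; case pj: (p j) => [e'|].
    + by move=> [<-] [ee']; apply: injp pi _; rewrite pj ee'.
    + case: pselect => //= Sj [ed] [ud]; case: (uX (v j)); left.
      by exists i; rewrite pi ud ed.
    + case: pselect => //= Si [ud] [ed]; case: (uX (v i)); left.
      by exists j; rewrite pj ud ed.
    + case: pselect => //= Si [<-]; case: pselect => //= Sj [/inju /esym].
      exact: injv.
  case pi: (p i) => [e|]; first by move=> [<-]; exact: pc pi.
  case: pselect => //= Si [<-]; split=> ue; case: (uX (v i)); right; rewrite ue;
    by [left|right].
- apply: card_le_trans (card_le_setU ple Sle); apply: subset_card_le => i.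
  rewrite /dom /q /=; case: (p i) => [d|]; first by left.
  by case: pselect => // Si _; right.
- by move=> i d; rewrite /q => ->.
- by move=> i Si; rewrite /dom /q /=; case: (p i) => //; case: pselect.
Qed.

Lemma injective_off_not_separated (U V : set (I -> D)) :
  (forall f, injective_off c0 f -> box_nbhs f U) ->
  (forall f, injective_off c1 f -> box_nbhs f V) -> U `&` V !=set0.
Proof.
move=> hU hV.
have HS p : exists S : set I, pinj p -> S #<= [set: K] /\
    forall g, (forall i, S i -> g i = fill p c0 i) -> U g.
  have [pp|np] := pselect (pinj p); last by exists set0.
  by have [S ? ?] := hU _ (fill_off pp (or_introl erefl)); exists S.
pose S p := sval (cid (HS p)).
have SP p (pp : pinj p) := svalP (cid (HS p)) pp.
pose R p q := extends p q /\ S p `<=` dom q.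
pose P (C : set (I -> option D)) :=
  (forall p, C p -> pinj p /\ dom p #<= [set: K]) /\
  (forall p q, C p -> C q -> [\/ p = q, R p q | R q p]).
have [F FP Ftot|C [[Cpinj Ctot] maxC]] := @Zorn_bigcup _ P.
  split=> [p [C FC Cp]|p q [C FC Cp] [C' FC' Cq]]; first exact: (FP _ FC).1.
  have [CC'|C'C] := Ftot _ _ FC FC'.
    by apply: (FP _ FC').2 => //; exact: CC'.
  by apply: (FP _ FC).2 => //; exact: C'C.
(* Members of the chain agree wherever both are defined, so their union [e] is a partial
   function. *)
have eH i : exists o : option D,
    forall d, o = Some d <-> exists2 p, C p & p i = Some d.
  have [[d [p Cp pid]]|nd] := pselect (exists d, exists2 p, C p & p i = Some d).
    exists (Some d) => d'; split=> [[<-]|[p' Cp' pid']]; first by exists p.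
    have [pp'|[pp' _]|[pp' _]] := Ctot _ _ Cp Cp'.
    - by rewrite -pp' pid in pid'.
    - by rewrite (pp' _ _ pid) in pid'.
    - by rewrite (pp' _ _ pid') in pid.
  by exists None => d; split=> // dP; case: nd; exists d.
pose e i := sval (cid (eH i)).
have eP i d : e i = Some d <-> _ := svalP (cid (eH i)) d.
have Ce p : C p -> extends p e by move=> Cp i d pid; apply/eP; exists p.
have e_pinj : pinj e.
  split=> [i j d /eP[p Cp pi] /eP[q Cq qj]|i d /eP[p Cp pi]]; last first.
    exact: (Cpinj _ Cp).1.2 pi.
  have [pq|[pq _]|[qp _]] := Ctot _ _ Cp Cq.
  - by rewrite -pq in qj; exact: (Cpinj _ Cp).1.1 pi qj.
  - exact: (Cpinj _ Cq).1.1 (pq _ _ pi) qj.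
  - exact: (Cpinj _ Cp).1.1 pi (qp _ _ qj).
(* Unless [p] is already the whole union, some member [q] goes beyond [p], and [R p q] puts [S p]
   inside [dom q]. *)
have S_or p : C p -> p = e \/ S p `<=` dom e.
  move=> Cp; have [pe|ne] := pselect (forall i, p i = e i).
    by left; exact/funext.
  have /existsNP[i pi] := ne; right.
  case ei : (e i) pi => [d|] pi; last first.
    by case pid : (p i) pi => [d|//] _; rewrite (Ce _ Cp _ _ pid) in ei.
  have [q Cq qi] := (eP _ _).1 ei.
  have [pq|[_ Spq]|[qp _]] := Ctot _ _ Cp Cq.
  - by rewrite pq in pi.
  - by apply: (subset_trans Spq); apply: extends_dom; exact: Ce.
  - by rewrite (qp _ _ qi) in pi.
have [G Gle GV] := hV _ (fill_off e_pinj (or_intror erefl)).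
have [p [Cp_ext Gp Sp] pp] : exists2 p,
    [/\ extends p e, G `&` dom e `<=` dom p & S p `<=` dom e] & pinj p.
  (* If [e] is small, take [p = e]: an extension [q] of [e] that covers [S e] lies above the whole
     chain, so by maximality it belongs to [C], whence [dom q] is inside [dom e]. *)
  have [ele|engt] := pselect (dom e #<= [set: K]).
    have [q [q_pinj qle eq Sq]] := extend_dom e_pinj ele (SP _ e_pinj).1.
    have RCq p : C p -> R p q.
      move=> Cp; split; first by move=> i d /(Ce _ Cp)/eq.
      have [->//|Sp] := S_or _ Cp.
      by apply: (subset_trans Sp); exact: extends_dom.
    have Cq : C q.
      apply: contrapT => nCq; apply: (maxC (C `|` [set q])).
        by split=> [p|sub]; [left|apply: nCq; apply: sub; right].
      split=> [p [/Cpinj//|->//]|p p' [Cp|->] [Cp'|->]].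
      - exact: Ctot.
      - by apply: Or32; exact: RCq.
      - by apply: Or33; exact: RCq.
      - exact: Or31.
    exists e => //; split=> //.
    by apply: (subset_trans Sq); apply: extends_dom; exact: Ce.
  (* If no single member covered [G] within [dom e], the members [w i] chosen at the points of that
     part would be cofinal in [C], making [dom e] a union of at most [K] small domains. *)
  have [p Cp Gp] : exists2 p, C p & G `&` dom e `<=` dom p.
    apply: contrapT => nG; apply: engt.
    have H i : exists p, (G `&` dom e) i -> C p /\ dom p i.
      have [[_ ei]|n] := pselect ((G `&` dom e) i); last by exists (fun=> None).
      case ei' : (e i) ei => [d|//] _; have [p Cp pi] := (eP _ _).1 ei'.
      by exists p; split=> //; rewrite /dom /= pi.
    pose w i := sval (cid (H i)); have wP i := svalP (cid (H i)).
    have le : \bigcup_(i in G `&` dom e) dom (w i) #<= [set: K].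
      apply: card_le_bigcup => [|i /wP[Cw _]]; last exact: (Cpinj _ Cw).2.
      exact: card_le_trans (subset_card_le (@subIsetl _ _ _)) Gle.
    apply: card_le_trans le; apply: subset_card_le => i.
    rewrite {1}/dom /=; case ei : (e i) => [d|//] _.
    have [p Cp pi] := (eP _ _).1 ei.
    have [j [Gj npj]] : exists j, (G `&` dom e) j /\ ~ dom p j.
      apply: contrapT => nj; apply: nG; exists p => // j Gj.
      by apply: contrapT => npj; apply: nj; exists j.
    exists j => //; have [Cw wj] := wP _ Gj.
    have [pw|[pw _]|[wp _]] := Ctot _ _ Cp Cw.
    - by case: npj; rewrite pw.
    - by apply: (extends_dom pw); rewrite /dom /= pi.
    - by case: npj; exact: extends_dom wp _ wj.
  have [p_pinj ple] := Cpinj _ Cp.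
  exists p => //; split=> //; first exact: Ce.
  by have [pe|//] := S_or _ Cp; case: engt; rewrite -pe.
(* This point agrees with [fill p c0] on [S p], and with [fill e c1] on [G]: a point of [G] in [S p]
   lies in [dom e], hence in [dom p]. *)
exists (fun i => if p i is Some d then d else
  if pselect (S p i) then c0 else fill e c1 i); split.
  apply: (SP _ pp).2 => i Si; rewrite /fill; case: (p i) => //=.
  by case: pselect.
apply: GV => i Gi.
case pi: (p i) => [d|]; first by rewrite /fill (Cp_ext _ _ pi).
case: pselect => //= Si.
by have := Gp i (conj Gi (Sp _ Si)); rewrite /dom /= pi.
Qed.

End Stone.
End InfiniteBound.

(** * Successor cardinals, and separation of closed sets *)

Lemma succ_card_ltE (K K1 : cardinal) T (A : set T) : is_succ_card K K1 ->
  card_lt A [set: K1] <-> A #<= [set: K].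
Proof.
move=> [[KK1 nK1K] K1min]; split=> [[_ nK1A]|AK].
  have [//|KA] := card_le_total A [set: K]; apply: contrapT => nAK.
  have E : [set: set_type A] #= A by exact: card_setT.
  apply: nK1A; rewrite -(card_le_eqr E); apply: K1min.
  by rewrite /card_lt (card_le_eqr E) (card_le_eql E).
split; first exact: card_le_trans AK KK1.
by move=> K1A; apply: nK1K; exact: card_le_trans K1A AK.
Qed.

Lemma normal_separated (T : topologicalType) (A B : set T) :
  normal_space T -> closed A -> closed B -> A `&` B = set0 ->
  exists2 U, (forall x, A x -> nbhs x U) & (forall x, B x -> nbhs x (~` U)).
Proof.
move=> nT cA cB AB0.
have [|U UA clU] := nT A cA (~` B).
  move=> x Ax; apply: open_nbhs_nbhs; split; first exact: closed_openC.
  by move=> Bx; have : (A `&` B) x by []; rewrite AB0.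
exists U => // x Bx; apply: (@filterS _ _ _ (~` closure U)).
  by apply: subsetC; exact: subset_closure.
apply: open_nbhs_nbhs; split; first exact/closed_openC/closed_closure.
by move=> /clU.
Qed.

(** The usual proof that paracompact regular spaces are normal, with clopen neighbourhoods in place
    of regularity: the cover consists of the clopen sets missing [B] and of the complement of
    [A]. *)
Lemma paracompact_separated (T : topologicalType) (A B : set T) :
  (forall (x : T) U, nbhs x U ->
    exists W, [/\ open W, closed W, W x & W `<=` U]) ->
  paracompact_space T -> closed A -> closed B -> A `&` B = set0 ->
  exists2 U, (forall x, A x -> nbhs x U) & (forall x, B x -> nbhs x (~` U)).
Proof.
move=> zdT pT cA cB AB0.
pose C : set (set T) :=
  [set W | [/\ open W, closed W & W `&` B = set0]] `|` [set ~` A].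
have [|| V [Vo Vcov VC lfV]] := pT C.
- by move=> W [[]//|->]; exact: closed_openC.
- apply/seteqP; split=> // x _; have [Ax|nAx] := pselect (A x); last first.
    by exists (~` A) => //; right.
  have [|W [oW cW Wx WB]] := zdT x (~` B).
    apply: open_nbhs_nbhs; split; first exact: closed_openC.
    by move=> Bx; have : (A `&` B) x by []; rewrite AB0.
  by exists W => //; left; split=> //; apply/seteqP; split=> // y [/WB].
have VA W : V W -> W `&` A !=set0 ->
    exists2 X, closed X & W `<=` X /\ X `&` B = set0.
  move=> /VC[X [[_ cX XB] WX _|-> WA [x [/WA]]//]]; by exists X.
exists (\bigcup_(W in [set W | V W /\ W `&` A !=set0]) W) => x.
  move=> Ax; have [W VW Wx] : (\bigcup_(W in V) W) x by rewrite Vcov.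
  apply: (@filterS _ _ _ W).
    by move=> y Wy; exists W => //; split=> //; exists x.
  by apply: open_nbhs_nbhs; split=> //; exact: Vo.
move=> Bx; have [N Nx finN] := lfV x.
set F := [set W | _] in finN.
(* Only finitely many relevant members meet [N], so the union of their closures is closed, and each
   closure misses [B]. *)
pose X := \bigcup_(W in F `&` [set W | W `&` A !=set0]) closure W.
have cX : closed X.
  apply: closed_bigcup => [|W _]; last exact: closed_closure.
  exact: sub_finite_set finN.
apply: (@filterS _ _ _ (N `&` ~` X)).
  move=> y [Ny nW] [W [VW WA] Wy]; apply: nW.
  exists W; last exact: subset_closure.
  by split=> //; split=> //; exists y.
apply: filterI => //; apply: open_nbhs_nbhs; split; first exact: closed_openC.
move=> [W [[VW _] WA] Wx]; have [Y cY [WY YB]] := VA _ VW WA.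
have : (Y `&` B) x.
  by split=> //; rewrite ((closure_id Y).1 cY); exact: closureS WY _ Wx.
by rewrite YB.
Qed.

(** * The topology of the box space and its inseparable closed sets *)

Section BoxTopology.
Variables K K1 L : cardinal.
Hypotheses (infK : infinite_set [set: K]) (K1E : is_succ_card K K1).

(** A basic open set involves finitely many partial functions, whose domains together still have
    size at most [K]; conversely the restriction of [f] to [S] is an admissible partial function. *)
Lemma nbhs_boxP (f : box_space K1 L) (U : set (box_space K1 L)) :
  nbhs f U <-> exists2 S : set L, S #<= [set: K] &
    forall g : box_space K1 L, (forall i, S i -> g i = f i) -> U g.
Proof.
split=> [|[S SK SU]].
  rewrite nbhsE => -[V [[B BI <-] [W BW Wf]] VU].
  have [E EI WE] := BI _ BW.
  exists (\bigcup_(s in [set` E]) dom s).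
    apply: (card_le_bigcup infK); first exact: finite_card_le.
    by move=> s /EI /set_mem /(succ_card_ltE _ K1E).
  move=> g gf; apply: VU; exists W => //.
  rewrite -WE in Wf *; move=> s Es a b sa.
  by rewrite gf; [exact: Wf Es _ _ sa|exists s => //; rewrite /dom /= sa].
pose s : partial_fun L := fun a => if pselect (S a) then Some (f a) else None.
have domS : dom s = S.
  by rewrite /dom /s; apply/seteqP; split=> a /=; case: pselect.
have sP g : @extensions K1 L s g <-> forall i, S i -> g i = f i.
  split=> gs i; first by move=> Si; apply: gs; rewrite /s; case: pselect.
  by move=> b; rewrite /s; case: pselect => // Si [<-]; exact: gs.
apply: (@filterS _ _ _ (@extensions K1 L s)); first by move=> g /sP; exact: SU.
apply: open_nbhs_nbhs; split; last exact/sP.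
exists [set @extensions K1 L s]; last by rewrite bigcup_set1.
by move=> _ ->; apply: finI_from1; apply/(succ_card_ltE _ K1E); rewrite domS.
Qed.

Lemma open_box (U : set (box_space K1 L)) :
  (forall f, U f -> exists2 S : set L, S #<= [set: K] &
    forall g : box_space K1 L, (forall i, S i -> g i = f i) -> U g) -> open U.
Proof. by move=> h; rewrite openE => f /h Uf; apply/nbhs_boxP. Qed.

Lemma box_zero_dimensional (f : box_space K1 L) U : nbhs f U ->
  exists W, [/\ open W, closed W, W f & W `<=` U].
Proof.
move=> /nbhs_boxP[S SK SU].
exists [set g : box_space K1 L | forall i, S i -> g i = f i]; split=> //.
  apply: open_box => g gf; exists S => // h hg i Si.
  by rewrite hg//; exact: gf.
rewrite -openC; apply: open_box => g ngf; exists S => // h hg hf.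
by apply: ngf => i Si; rewrite -hf// hg.
Qed.

Hypothesis K1L : card_lt [set: K1] [set: L].

Lemma box_nonseparated : exists A B : set (box_space K1 L),
  [/\ closed A, closed B, A `&` B = set0 &
  ~ exists2 U, (forall x, A x -> nbhs x U) & (forall x, B x -> nbhs x (~` U))].
Proof.
have [k0 _] := infinite_setN0 infK.
have [KK1 nK1K] := K1E.1.
have KL : [set: K] #<= [set: L] := card_le_trans KK1 K1L.1.
have infL : infinite_set [set: L].
  by move=> /(card_le_finite KL).
have infK1 : infinite_set [set: K1].
  by move=> /(card_le_finite KK1).
have [l0 _] := infinite_setN0 infL.
have [s [_ injs]] : exists s : nat -> K1,
    (forall n, setT n -> setT (s n)) /\ inj_on setT s.
  have [c _] := infinite_setN0 infK1.
  by apply/(card_le_injP _ _ c)/infiniteP.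
have s01 : s 0%N <> s 1%N by move=> /(injs _ _ I I).
(* By Cantor's theorem the power set of [K] is above [K], hence at least its successor [K1]. *)
have [d [_ injd]] : exists d : K1 -> set K,
    (forall x, setT x -> setT (d x)) /\ inj_on setT d.
  by apply/(card_le_injP _ _ set0)/K1E.2; exact: card_lt_powerset.
have [e [_ inje]] : exists e : K -> L,
    (forall x, setT x -> setT (e x)) /\ inj_on setT e.
  exact/(card_le_injP _ _ l0).
have [p [_ injp]] : exists p : L * L -> L,
    (forall x, setT x -> setT (p x)) /\ inj_on setT p.
  by apply/(card_le_injP _ _ l0); exact: card_le_square.
(* [J] places entry [k] of row [i] among the coordinates; coordinates off its range belong to no
   row. *)
pose J ik := p (ik.1, e ik.2).
have injJ : inj_on setT J.
  by move=> [i k] [i' k'] _ _ /(injp _ _ I I)[-> /(inje _ _ I I) ->].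
have [J' J'K] := inj_on_inv (l0, k0) injJ.
pose row (x : box_space K1 L) i : set K := [set k | x (J (i, k))].
pose Q c : set (box_space K1 L) := [set x | forall i j, range d (row x i) /\
  (row x i = row x j -> i = j \/ row x i = d c)].
have cQ c : closed (Q c).
  (* A failure of the condition is visible on two rows, that is, on at most [K] coordinates. *)
  rewrite -openC; apply: open_box => x nQx.
  have [i [j nij]] : exists i j, ~ (range d (row x i) /\
      (row x i = row x j -> i = j \/ row x i = d c)).
    apply: contrapT => h; apply: nQx => i j; apply: contrapT => nij.
    by apply: h; exists i, j.
  exists ((fun k => J (i, k)) @` setT `|` (fun k => J (j, k)) @` setT).
    by apply: card_le_setU => //; exact: card_image_le.
  move=> y yx Qy; apply: nij.
  have -> : row x i = row y i.
    by apply/funext => k; rewrite /row /= yx//; left; exists k.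
  have -> : row x j = row y j.
    by apply/funext => k; rewrite /row /= yx//; right; exists k.
  exact: Qy.
(* For a common point, a repeated row would equal both [d (s 0)] and [d (s 1)]; so no row repeats,
   and the names of the rows inject [L] into [K1]. *)
have Q01 : Q (s 0%N) `&` Q (s 1%N) = set0.
  apply/seteqP; split=> // x [Q0 Q1]; apply: K1L.2.
  apply/(card_le_injP _ _ (s 0%N)).
  have H i : exists c, d c = row x i by have [[c _ <-] _] := Q0 i i; exists c.
  exists (fun i => sval (cid (H i))); split=> // i j _ _ eij.
  have rij : row x i = row x j.
    by rewrite -(svalP (cid (H i))) eij (svalP (cid (H j))).
  have [//|r0] := (Q0 i j).2 rij; have [//|r1] := (Q1 i j).2 rij.
  by case: s01; apply: injd => //; rewrite -r0.
pose code (f : L -> K1) : box_space K1 L := fun l =>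
  `[< d (f (J' l).1) (J' l).2 >].
have rowE f i : row (code f) i = d (f i).
  apply/funext => k; rewrite /row /code /= J'K//=.
  by apply/propext; split=> /asboolP.
have codeQ c f : injective_off c f -> Q c (code f).
  move=> fc i j; rewrite !rowE; split; first by exists (f i).
  by move=> /(injd _ _ I I)/fc[]; [left|right; congr d].
(* Each coordinate of [code f] depends on a single value of [f], so [code] pulls neighbourhoods back
   to neighbourhoods. *)
have code_nbhs f U : nbhs (code f) U -> box_nbhs K f (code @^-1` U).
  move=> /nbhs_boxP[S SK SU]; exists ((fun l => (J' l).1) @` S).
    exact: card_le_trans (card_image_le _ _) SK.
  by move=> g gf; apply: SU => l Sl; rewrite /code gf//; exists l.
exists (Q (s 0%N)), (Q (s 1%N)); split=> // -[U QU QnU].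
have [||f [Uf nUf]] := @injective_off_not_separated _ infK
    L _ (s 0%N) (s 1%N) nK1K (code @^-1` U) (code @^-1` (~` U)).
- by move=> f /codeQ/QU; exact: code_nbhs.
- by move=> f /codeQ/QnU; exact: code_nbhs.
exact: nUf.
Qed.

End BoxTopology.

(** The successor of a finite cardinal n is at most n + 1, hence finite. *)
Lemma infinite_of_succ_card (K K1 : cardinal) :
  is_succ_card K K1 -> infinite_set [set: K1] -> infinite_set [set: K].
Proof.
move=> [_ K1min] infK1 [n Kn]; apply: infK1.
have E : [set: set_type `I_n.+1] #= `I_n.+1 by exact: card_setT.
apply: (@card_le_finite _ _ _ `I_n.+1); last exact: finite_II.
rewrite -(card_le_eqr E); apply: K1min.
rewrite /card_lt (card_le_eqr E) (card_le_eql E) (card_le_eql Kn).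
by rewrite (card_le_eqr Kn) !card_le_II leqnSn ltnn.
Qed.

Theorem theorem7p8 :
  (forall mu : cardinal,
     infinite_set [set: mu] ->
     (exists kappa : cardinal, is_succ_card kappa mu) ->
     ~ paracompact_card mu) /\
  ~ (exists kappa kappa1 kappa2 : cardinal,
       [/\ infinite_set [set: kappa],
           is_succ_card kappa kappa1,
           is_succ_card kappa1 kappa2 &
           normal_space (box_space kappa1 kappa2)]).
Proof.
split=> [mu infmu [kappa succ_mu] pmu|
  [kappa [kappa1 [kappa2 [infk k1 k2 normal]]]]].
  (* Paracompactness is refuted at the successor of [mu]. *)
  have [lambda [mu_lt _]] := exists_succ_card mu.
  have infk := infinite_of_succ_card succ_mu infmu.
  have [A [B [cA cB AB0]]] := box_nonseparated infk succ_mu mu_lt; apply.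
  apply: paracompact_separated => //; last exact: pmu mu_lt.1.
  exact: (box_zero_dimensional infk succ_mu).
have [A [B [cA cB AB0]]] := box_nonseparated infk k1 k2.1; apply.
exact: normal_separated.
Qed.
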